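(* The data $(U_-,X)$ are informative for stabilization by state feedback if and only if the matrix $X_-$ has full row rank and there exists a right inverse $X_-^\dagger$ of $X_-$ such that $X_+X_-^\dagger$ is stable. Moreover, $K\in\mathbb{R}^{m\times n}$ is such that $\Sigma_{i/s}\subseteq\Sigma_K$ if and only if $K=U_-X_-^\dagger$ for some right inverse $X_-^\dagger$ of $X_-$ such that $X_+X_-^\dagger$ is stable.
   Context: Fix positive integers $n,m,q,T_1,\dots,T_q$. Let $(A_s,B_s)\in\mathbb{R}^{n\times n}\times\mathbb{R}^{n\times m}$ be the 'true' system $x(t+1)=A_sx(t)+B_su(t)$. For $i=1,\dots,q$ let $u^i(0),\dots,u^i(T_i-1)\in\mathbb{R}^m$ and $x^i(0),\dots,x^i(T_i)\in\mathbb{R}^n$ be input/state data generated by this system, i.e. $x^i(t+1)=A_sx^i(t)+B_su^i(t)$ for $t=0,\dots,T_i-1$. Put $U^i_-=[u^i(0)\ \cdots\ u^i(T_i-1)]$, $X^i=[x^i(0)\ \cdots\ x^i(T_i)]$, $X^i_-=[x^i(0)\ \cdots\ x^i(T_i-1)]$, $X^i_+=[x^i(1)\ \cdots\ x^i(T_i)]$, and $U_-=[U^1_-\ \cdots\ U^q_-]$, $X=[X^1\ \cdots\ X^q]$, $X_-=[X^1_-\ \cdots\ X^q_-]$, $X_+=[X^1_+\ \cdots\ X^q_+]$; thus $X_+=A_sX_-+B_sU_-$. The set of systems consistent with the data is $$\Sigma_{i/s}=\Big\{(A,B)\in\mathbb{R}^{n\times n}\times\mathbb{R}^{n\times m}\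 \Big|\ X_+=\begin{bmatrix}A & B\end{bmatrix}\begin{bmatrix}X_- \\ U_- \end{bmatrix}\Big\}.$$ A square matrix is stable if all its eigenvalues lie in the open unit disk. For $K\in\mathbb{R}^{m\times n}$, $\Sigma_K=\{(A,B)\mid A+BK\text{ is stable}\}$. The data are informative for stabilization by state feedback if there exists $K$ with $\Sigma_{i/s}\subseteq\Sigma_K$. A right inverse of $X_-$ is a real matrix $X_-^\dagger$ with $X_-X_-^\dagger=I$. *)

(* Defs.v *)
From mathcomp Require Import all_boot all_order all_algebra.
From mathcomp Require Import boolp classical_sets reals.
From mathcomp Require Export complex.
Set Implicit Arguments.
Unset Strict Implicit.
Unset Printing Implicit Defensive.
Import Order.TTheory GRing.Theory Num.Theory.
Local Open Scope classical_set_scope.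
Local Open Scope ring_scope.

(* Experiment i < q has length T i, with inputs u i t for t < T i and states
   x i t for t <= T i, all given as column vectors. *)

Definition generated_by (R : realType) (n m q : nat) (T : 'I_q -> nat)
    (As : 'M[R]_n) (Bs : 'M[R]_(n, m))
    (u : forall i : 'I_q, 'I_(T i) -> 'cV[R]_m)
    (x : forall i : 'I_q, 'I_(T i).+1 -> 'cV[R]_n) : Prop :=
  forall (i : 'I_q) (t : 'I_(T i)),
    x i (lift ord0 t) = As *m x i (widen_ord (leqnSn (T i)) t) + Bs *m u i t.

Definition Uminus (R : realType) (m q : nat) (T : 'I_q -> nat)
    (u : forall i : 'I_q, 'I_(T i) -> 'cV[R]_m) : 'M[R]_(m, \sum_i T i) :=
  \mxrow_(i < q) \matrix_(k < m, t < T i) u i t k 0.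

Definition Xminus (R : realType) (n q : nat) (T : 'I_q -> nat)
    (x : forall i : 'I_q, 'I_(T i).+1 -> 'cV[R]_n) : 'M[R]_(n, \sum_i T i) :=
  \mxrow_(i < q)
    \matrix_(k < n, t < T i) x i (widen_ord (leqnSn (T i)) t) k 0.

Definition Xplus (R : realType) (n q : nat) (T : 'I_q -> nat)
    (x : forall i : 'I_q, 'I_(T i).+1 -> 'cV[R]_n) : 'M[R]_(n, \sum_i T i) :=
  \mxrow_(i < q) \matrix_(k < n, t < T i) x i (lift ord0 t) k 0.

Definition Sigma_is (R : realType) (n m q : nat) (T : 'I_q -> nat)
    (u : forall i : 'I_q, 'I_(T i) -> 'cV[R]_m)
    (x : forall i : 'I_q, 'I_(T i).+1 -> 'cV[R]_n) :
    set ('M[R]_n * 'M[R]_(n, m)) :=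
  [set AB | Xplus x = row_mx AB.1 AB.2 *m col_mx (Xminus x) (Uminus u)].

(* Eigenvalues are taken over the complex numbers; `|z| is the modulus, which
   is a real element of R[i] and hence comparable with 1. *)
Definition stable (R : realType) (n : nat) (M : 'M[R]_n) : Prop :=
  forall z : R[i], eigenvalue (map_mx (real_complex R) M) z -> `|z| < 1.

Definition Sigma_K (R : realType) (n m : nat) (K : 'M[R]_(m, n)) :
    set ('M[R]_n * 'M[R]_(n, m)) :=
  [set AB | stable (AB.1 + AB.2 *m K)].

Definition informative_for_stabilization (R : realType) (n m q : nat)
    (T : 'I_q -> nat)
    (u : forall i : 'I_q, 'I_(T i) -> 'cV[R]_m)
    (x : forall i : 'I_q, 'I_(T i).+1 -> 'cV[R]_n) : Prop :=
  exists K : 'M[R]_(m, n), Sigma_is u x `<=` Sigma_K K.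

Definition right_inverse_mx (R : realType) (n p : nat)
    (M : 'M[R]_(n, p)) (N : 'M[R]_(p, n)) : Prop :=
  M *m N = 1%:M.

(* Main.v *)
(** If every consistent [A + B K] is stable and [C [X_-; U_-] = 0], then for
    every [F] and every scalar [a] the matrix [M + a F C [I; K]] is stable,
    where [M = As + Bs K].  The trace of a stable matrix is at most [n], and
    the trace of this family is affine in [a], so [tr (F C [I; K]) = 0]; taking
    [F = (C [I; K])^T] forces [C [I; K] = 0].  Thus every linear relation
    between the rows of [[X_-; U_-]] also holds for the rows of [[I; K]], which
    gives [[I; K] = [X_-; U_-] Xdag], and [X_+ Xdag = M].  Only the bound on
    traces is needed, so the spectral radius never enters. *)
Require Import Defs.
From mathcomp Require Import all_boot all_order all_algebra.
From mathcomp Require Import boolp classical_sets reals.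
Set Implicit Arguments.
Unset Strict Implicit.
Unset Printing Implicit Defensive.
Import Order.TTheory GRing.Theory Num.Theory.
Local Open Scope classical_set_scope.
Local Open Scope ring_scope.

(** Over [R[i]] the trace is the sum of the [n] roots of the characteristic polynomial, each of
    modulus below 1. *)
Lemma stable_trace_le (R : realType) (n : nat) (M : 'M[R]_n) :
  (0 < n)%N -> stable M -> \tr M <= n%:R.
Proof.
move=> n_gt0 stM; rewrite -lecR rmorph_nat -trace_map_mx.
set MC := map_mx _ M.
have [r chiE] := closed_field_poly_normal (char_poly MC).
move: chiE; rewrite (monicP (char_poly_monic MC)) scale1r => chiE.
have szr : size r = n.
  by have := size_char_poly MC; rewrite chiE size_prod_XsubC => -[].
have trE : \tr MC = \sum_(z <- r) z.
  (* Both sides, negated, are the coefficient of degree [n.-1] of the characteristic polynomial. *)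
  apply: oppr_inj; rewrite -char_poly_trace // chiE -szr coefPn_prod_XsubC //.
  by rewrite szr -lt0n.
(* The order on [R[i]] is partial; a number is bounded by its modulus here because it is real. *)
have tr_real : \tr MC \is Num.real.
  by rewrite trace_map_mx complex_real.
apply: le_trans (real_ler_norm tr_real) _; rewrite trE.
apply: le_trans (ler_norm_sum _ _ _) _.
have -> : n%:R = \sum_(z <- r) 1 :> R[i].
  by rewrite big_const_seq count_predT iter_addr_0 szr.
rewrite big_seq [leRHS]big_seq; apply: ler_sum => z zr.
by apply/ltW/stM; rewrite eigenvalue_root_char chiE root_prod_XsubC.
Qed.

Lemma stable_line_trace_eq0 (R : realType) (n : nat) (M N : 'M[R]_n) :
  (0 < n)%N -> (forall a, stable (M + a *: N)) -> \tr N = 0.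
Proof.
move=> n_gt0 st; apply/eqP/negP => /negP trN0.
(* This scalar makes the trace of [M + a *: N] equal to [n.+1], above the bound. *)
have := stable_trace_le n_gt0 (st ((n.+1%:R - \tr M) / \tr N)).
by rewrite mxtraceD mxtraceZ divfK // addrC subrK ler_nat ltnn.
Qed.

(** The trace is the sum of the squares of all entries of [A]. *)
Lemma mxtrace_tr_mul_eq0 (R : realDomainType) (m n : nat) (A : 'M[R]_(m, n)) :
  \tr (A^T *m A) = 0 -> A = 0.
Proof.
have sq_ge0 k l : 0 <= A^T k l * A l k by rewrite mxE -expr2 sqr_ge0.
move=> /psumr_eq0P tr0; apply/matrixP => i j; rewrite mxE.
have/(_ j isT) : forall k, true -> (A^T *m A) k k = 0.
  by apply: tr0 => k _; rewrite mxE sumr_ge0.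
rewrite mxE => /psumr_eq0P/(_ i isT)/eqP.
by rewrite mxE mulf_eq0 orbb => /(_ (fun l _ => sq_ge0 j l))/eqP.
Qed.

Lemma factor_of_left_annihilator (F : fieldType) (m n p : nat)
    (A : 'M[F]_(m, p)) (B : 'M[F]_(m, n)) :
  (forall C : 'M[F]_m, C *m B = 0 -> C *m A = 0) ->
  exists D : 'M[F]_(n, p), A = B *m D.
Proof.
move=> annBA; have /submxP[D AE] : (A^T <= B^T)%MS.
  (* The hypothesis is applied to the transpose of [cokermx B^T], which annihilates [B] from the
     left. *)
  rewrite submxE -[_ *m _]trmxK trmx_mul trmxK annBA ?trmx0 //.
  by apply: trmx_inj; rewrite trmx_mul trmxK trmx0 mulmx_coker.
by exists D^T; rewrite -[A]trmxK AE trmx_mul trmxK.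
Qed.

Lemma Xplus_generated (R : realType) (n m q : nat) (T : 'I_q -> nat)
    (As : 'M[R]_n) (Bs : 'M[R]_(n, m))
    (u : forall i : 'I_q, 'I_(T i) -> 'cV[R]_m)
    (x : forall i : 'I_q, 'I_(T i).+1 -> 'cV[R]_n) :
  generated_by As Bs u x ->
  Xplus x = As *m Xminus x + Bs *m Uminus u.
Proof.
move=> data; rewrite /Xplus /Xminus /Uminus !mul_mxrow -mxrowD.
congr mxrow; apply: functional_extensionality_dep => i.
apply/matrixP => k t; rewrite !mxE data !mxE.
by congr (_ + _); apply: eq_bigr => l _; rewrite !mxE.
Qed.

Lemma Sigma_isE (R : realType) (n m q : nat) (T : 'I_q -> nat)
    (u : forall i : 'I_q, 'I_(T i) -> 'cV[R]_m)
    (x : forall i : 'I_q, 'I_(T i).+1 -> 'cV[R]_n)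
    (A : 'M[R]_n) (B : 'M[R]_(n, m)) :
  Sigma_is u x (A, B) <-> Xplus x = A *m Xminus x + B *m Uminus u.
Proof. by rewrite /Sigma_is /= mul_row_col. Qed.

Lemma Sigma_is_sub_right_inverse (R : realType) (n m q : nat) (T : 'I_q -> nat)
    (As : 'M[R]_n) (Bs : 'M[R]_(n, m))
    (u : forall i : 'I_q, 'I_(T i) -> 'cV[R]_m)
    (x : forall i : 'I_q, 'I_(T i).+1 -> 'cV[R]_n) (K : 'M[R]_(m, n)) :
  (0 < n)%N -> Sigma_is u x (As, Bs) -> Sigma_is u x `<=` Sigma_K K ->
  exists Xdag : 'M[R]_(\sum_i T i, n),
    [/\ right_inverse_mx (Xminus x) Xdag,
        stable (Xplus x *m Xdag) &
        K = Uminus u *m Xdag].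
Proof.
move=> n_gt0 sigAB sub.
have [Xdag] : exists D, col_mx 1%:M K = col_mx (Xminus x) (Uminus u) *m D.
  apply: factor_of_left_annihilator => C CW0.
  apply: mxtrace_tr_mul_eq0; set F := (C *m _)^T.
  apply: (@stable_line_trace_eq0 _ _ (As + Bs *m K)) => // a.
  (* [G] perturbs [[As Bs]]. By [GE], it vanishes on the data since [C] does, and it shifts the
     closed loop by [a] times [F C [I; K]]. *)
  pose G := a *: (F *m C).
  have GE p (V : 'M_(n, p)) (W : 'M_(m, p)) :
      lsubmx G *m V + rsubmx G *m W = a *: (F *m (C *m col_mx V W)).
    by rewrite -mul_row_col hsubmxK -scalemxAl mulmxA.
  have : Sigma_is u x (As + lsubmx G, Bs + rsubmx G).
    apply/Sigma_isE; rewrite !mulmxDl addrACA GE CW0 mulmx0 scaler0 addr0.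
    exact/Sigma_isE.
  move/sub; rewrite /Sigma_K /= mulmxDl addrACA -{1}[lsubmx G]mulmx1 GE.
  by [].
rewrite mul_col_mx => /eq_col_mx[XD1 KE]; exists Xdag; split=> //.
(* Multiplying the data equation by [Xdag] gives [As + Bs *m K], which is stable since [(As, Bs)] is
   itself consistent. *)
have /Sigma_isE -> := sigAB.
by rewrite mulmxDl -!mulmxA -XD1 -KE mulmx1; apply: (sub (As, Bs)).
Qed.

(** With this gain all consistent systems share one closed loop: multiplying their data equation by
    [Xdag] turns [A + B K] into [Xplus x *m Xdag]. *)
Lemma right_inverse_Sigma_is_sub (R : realType) (n m q : nat) (T : 'I_q -> nat)
    (u : forall i : 'I_q, 'I_(T i) -> 'cV[R]_m)
    (x : forall i : 'I_q, 'I_(T i).+1 -> 'cV[R]_n)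
    (Xdag : 'M[R]_(\sum_i T i, n)) :
  right_inverse_mx (Xminus x) Xdag -> stable (Xplus x *m Xdag) ->
  Sigma_is u x `<=` Sigma_K (Uminus u *m Xdag).
Proof.
move=> XD1 st [A B] /Sigma_isE XpE; move: st.
by rewrite XpE mulmxDl -!mulmxA XD1 mulmx1.
Qed.

Theorem theorem16 (R : realType) (n m q : nat) (T : 'I_q -> nat)
    (n_gt0 : (0 < n)%N) (m_gt0 : (0 < m)%N) (q_gt0 : (0 < q)%N)
    (T_gt0 : forall i : 'I_q, (0 < T i)%N)
    (As : 'M[R]_n) (Bs : 'M[R]_(n, m))
    (u : forall i : 'I_q, 'I_(T i) -> 'cV[R]_m)
    (x : forall i : 'I_q, 'I_(T i).+1 -> 'cV[R]_n)
    (data : generated_by As Bs u x) :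
  (informative_for_stabilization u x <->
     row_free (Xminus x) /\
     exists Xdag : 'M[R]_(\sum_i T i, n),
       right_inverse_mx (Xminus x) Xdag /\ stable (Xplus x *m Xdag))
  /\
  (forall K : 'M[R]_(m, n),
     Sigma_is u x `<=` Sigma_K K <->
     exists Xdag : 'M[R]_(\sum_i T i, n),
       [/\ right_inverse_mx (Xminus x) Xdag,
           stable (Xplus x *m Xdag) &
           K = Uminus u *m Xdag]).
Proof.
have sigAB : Sigma_is u x (As, Bs) by apply/Sigma_isE/Xplus_generated.
have subP := Sigma_is_sub_right_inverse n_gt0 sigAB.
split; last first.
  move=> K; split; first exact: subP.
  by move=> [Xdag [XD1 st ->]]; apply: right_inverse_Sigma_is_sub.
split=> [[K /subP[Xdag [XD1 st _]]]|[_ [Xdag [XD1 st]]]].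
  by split; [apply/row_freeP; exists Xdag | exists Xdag].
by exists (Uminus u *m Xdag); apply: right_inverse_Sigma_is_sub.
Qed.
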